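(* We have $n_2(4,1,1)=n_2(4,2,1)=8$, $n_2(4,3,1)=n_2(4,4,1)=10$, $n_2(4,5,1)=n_2(4,6,1)=14$, $n_2(4,7,1)=n_2(4,8,1)=16$, $n_2(4,9,1)=20$, $n_2(4,10,1)=22$, $n_2(4,11,1)=23$, $n_2(4,12,1)=24$, $n_2(4,13,1)=27$, $n_2(4,14,1)=28$, $n_2(4,15,1)=30$, and $n_2(4,d,1)=n_2(4,d)$ for all $d\ge 16$.
   Context: An $[n,k,d]_q$-code is a $k$-dimensional subspace of $\mathbb{F}_q^n$ with minimum Hamming distance at least $d$. $n_q(k,d)$ denotes the minimum length $n$ of an $[n,k,d]_q$-code. A linear code $C\subseteq\mathbb{F}_q^n$ has locality $r$ if for every coordinate $i$ there is a set $S_i\subseteq\{1,\dots,n\}\setminus\{i\}$ with $|S_i|\le r$ such that any two codewords agreeing on all coordinates in $S_i$ also agree in coordinate $i$. $n_q(k,d,r)$ denotes the minimum length $n$ of an $[n,k,d]_q$-code with locality $r$. *)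

(* Defs.v *)
From HB Require Import structures.
From mathcomp Require Import all_boot all_order all_algebra.

Set Implicit Arguments.
Unset Strict Implicit.
Unset Printing Implicit Defensive.

Import GRing.Theory.
Local Open Scope ring_scope.

Definition hamming_dist (F : finFieldType) (n : nat) (x y : 'rV[F]_n) : nat :=
  #|[set i : 'I_n | x 0 i != y 0 i]|.

Definition is_code (F : finFieldType) (n k d : nat) (C : {vspace 'rV[F]_n}) :
    Prop :=
  \dim C = k /\
  (forall x y : 'rV[F]_n, x \in C -> y \in C -> x != y ->
     (d <= hamming_dist x y)%N).

Definition has_locality (F : finFieldType) (n r : nat)
    (C : {vspace 'rV[F]_n}) : Prop :=
  forall i : 'I_n, exists S : {set 'I_n},
    [/\ i \notin S,
        (#|S| <= r)%N
      & forall x y : 'rV[F]_n, x \in C -> y \in C ->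
          (forall j, j \in S -> x 0 j = y 0 j) -> x 0 i = y 0 i].

Definition code_length (F : finFieldType) (k d n : nat) : Prop :=
  exists C : {vspace 'rV[F]_n}, is_code k d C.

Definition loc_code_length (F : finFieldType) (k d r n : nat) : Prop :=
  exists C : {vspace 'rV[F]_n}, is_code k d C /\ has_locality r C.

Definition is_minimum (P : nat -> Prop) (n : nat) : Prop :=
  P n /\ (forall m, P m -> (n <= m)%N).

(* [min_length F k d n] and [min_loc_length F k d r n] are the graphs of the
   quantities n_q(k,d) and n_q(k,d,r), q = #|F|: each says that the minimum is
   attained (so that it is defined) and that it equals n. *)
Definition min_length (F : finFieldType) (k d n : nat) : Prop :=
  is_minimum (code_length F k d) n.

Definition min_loc_length (F : finFieldType) (k d r n : nat) : Prop :=
  is_minimum (loc_code_length F k d r) n.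

(* Main.v *)
Require Import Defs.
From HB Require Import structures.
From mathcomp Require Import all_boot all_order all_algebra zify.

Set Implicit Arguments.
Unset Strict Implicit.
Unset Printing Implicit Defensive.

(* Over F_2, locality 1 means that every nonzero column of a generator matrix is
   repeated. Merging equal columns turns the code into one with multiplicities
   m_j <> 1 on its coordinates.

   Lower bounds: if all m_j are even, halving them gives the bound
   2 * g(k, ceil(d/2)), where g is the Griesmer bound; otherwise some m_p >= 3,
   and shortening at p loses at least 3 coordinates and one dimension. This
   settles every case but d = 10, where length 21 has to be excluded: then
   m_j is 0, 2 or 3, and with h, e, o counting the coordinates of nonzero
   multiplicity, of multiplicity 2 and of multiplicity 3, one is left with
   (h, o) = (8, 5), (9, 3) or (10, 1).

   Upper bounds: a multiset of columns S + S + T with T contained in S has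
   locality 1; for d >= 16 take S = PG(3,2), so that 2 S + T runs through
   Belov-type codes attaining the Griesmer bound. *)

Import GRing.Theory.
Local Open Scope nat_scope.

Lemma F2_neq0D (a b : 'F_2) : (a + b != 0)%R = (a != 0%R) (+) (b != 0%R).
Proof. by case: a b => [[|[|//]] ?] [[|[|//]] ?]. Qed.

(** * Weighted binary codes: residuals, shortening and the Griesmer bound *)

Section WeightedCodes.
Variable n : nat.
Implicit Types (m h : 'I_n -> nat) (D : {vspace 'rV['F_2]_n}).
Implicit Types x y : 'rV['F_2]_n.

Definition mass m := \sum_j m j.

Definition wt m x := \sum_j m j * (x ord0 j != 0%R).

Definition min_wt_ge D m d := forall x, x \in D -> x != 0%R -> d <= wt m x.

Definition residue m x j := m j * (x ord0 j == 0%R).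

(** On the support of [x] exactly one of [y] and [x + y] is nonzero; off it they agree. *)
Lemma wt_residue m x y :
  wt m y + wt m (x + y)%R = wt m x + (wt (residue m x) y).*2.
Proof.
rewrite /wt -muln2 big_distrl -!big_split /=; apply: eq_bigr => j _.
rewrite mxE F2_neq0D /residue.
by case: (x _ _ == _); case: (y _ _ == _) => /=; lia.
Qed.

Lemma mass_residue m x : mass m = wt m x + mass (residue m x).
Proof.
rewrite /mass /wt -big_split; apply: eq_bigr => j _ /=.
by rewrite /residue; case: (x _ _ == _) => /=; lia.
Qed.

Lemma leq_wt_mass m x : wt m x <= mass m.
Proof. by rewrite (mass_residue m x) leq_addr. Qed.

Lemma min_wt_geW D m d d' : d' <= d -> min_wt_ge D m d -> min_wt_ge D m d'.
Proof. by move=> le_d' min_d x xD x0; rewrite (leq_trans le_d') ?min_d. Qed.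

Lemma complement_word D x k : k < \dim D -> x \in D -> x != 0%R ->
  exists2 D' : {vspace 'rV['F_2]_n}, k <= \dim D' &
    forall y, y \in D' -> y != 0%R ->
      [/\ y \in D, (x + y)%R \in D & (x + y != 0)%R].
Proof.
move=> dimD xD x0; exists (D :\: <[x]>)%VS => [|y yD' y0].
  have := dimv_cap_compl D <[x]>.
  have := dimvS (capvSr D <[x]>); rewrite dim_vline x0; lia.
have yD : y \in D by apply: (subvP (diffvSl D <[x]>)).
split=> //; first exact: memvD.
apply: contra y0; rewrite addrC addr_eq0 => /eqP y_x.
rewrite -memv0 -(capv_diff D <[x]>) memv_cap yD' y_x.
by rewrite memvN memv_line.
Qed.

Lemma shorten D (c : 'cV['F_2]_n) :
  exists2 D' : {vspace 'rV['F_2]_n}, (\dim D).-1 <= \dim D' &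
    forall x, x \in D' -> x \in D /\ (x *m c = 0)%R.
Proof.
pose f := linfun (mulmxr c : 'rV['F_2]_n -> 'M['F_2]_1).
exists (D :&: lker f)%VS => [|x].
  have := limg_ker_dim f D; have := dimvS (subvf (f @: D)).
  rewrite dimvf dim_matrix => le1 <-.
  by rewrite -subn1 leq_subLR addnC leq_add2r.
by rewrite memv_cap memv_ker lfunE /= => /andP[-> /eqP].
Qed.

Lemma shorten_coord D p :
  exists2 D' : {vspace 'rV['F_2]_n}, (\dim D).-1 <= \dim D' &
    forall x, x \in D' -> x \in D /\ x ord0 p = 0%R.
Proof.
have [D' dimD' D'P] := shorten D (delta_mx p ord0).
exists D' => // x /D'P[xD]; rewrite -colE => /matrixP/(_ ord0 ord0).
by rewrite !mxE.
Qed.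

Lemma shorten_eq D p q :
  exists2 D' : {vspace 'rV['F_2]_n}, (\dim D).-1 <= \dim D' &
    forall x, x \in D' -> x \in D /\ x ord0 p = x ord0 q.
Proof.
have [D' dimD' D'P] := shorten D (delta_mx p ord0 - delta_mx q ord0)%R.
exists D' => // x /D'P[xD]; rewrite mulmxBr -!colE => /matrixP/(_ ord0 ord0).
by rewrite !mxE => /eqP; rewrite subr_eq0 => /eqP.
Qed.

(** Both [y] and [x + y] weigh at least [d], so [wt_residue] bounds the weight of [y] off the
    support of [x]. *)
Lemma residual_code D m d k x :
    k < \dim D -> min_wt_ge D m d -> x \in D -> x != 0%R ->
  exists2 D' : {vspace 'rV['F_2]_n}, k <= \dim D' &
    min_wt_ge D' (residue m x) (uphalf (d.*2 - wt m x)).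
Proof.
move=> dimD min_d xD x0; have [D' dimD' D'P] := complement_word dimD xD x0.
exists D' => // y yD' y0; have [yD xyD xy0] := D'P y yD' y0.
have := wt_residue m x y; have := min_d _ yD y0; have := min_d _ xyD xy0.
by lia.
Qed.

Fixpoint griesmer k d := if k is k'.+1 then d + griesmer k' (uphalf d) else 0.

Lemma griesmer_bound k D m d :
  k <= \dim D -> min_wt_ge D m d -> griesmer k d <= mass m.
Proof.
elim: k D m d => // k IHk D m d dimD min_d.
have [x0 x0P] : exists x, (x \in D) && (x != 0%R).
  exists (vpick D); rewrite memv_pick vpick0.
  by apply: contraTneq dimD => ->; rewrite dimv0.
(* For a word of minimum weight [w], the residual bound [uphalf (w.*2 - w)] is [uphalf w]. *)
pose x := [arg min_(y < x0 | (y \in D) && (y != 0%R)) wt m y].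
have [xD xn0 x_min] : [/\ x \in D, x != 0%R & min_wt_ge D m (wt m x)].
  rewrite /x; case: arg_minnP => // y /andP[yD y0] y_min; split=> // z zD z0.
  by apply: y_min; rewrite zD.
have le_d := min_d x xD xn0.
have [D' dimD' min_D'] := residual_code dimD x_min xD xn0.
rewrite (mass_residue m x) /= leq_add //; apply: IHk dimD' _.
by apply: min_wt_geW min_D'; lia.
Qed.

(** Multiplicity 0 stands for a deleted coordinate, so the ambient space stays fixed. *)
Definition zero_at m p j := if j == p then 0 else m j.

Lemma wt_zero_at m x p : x ord0 p = 0%R ->
  wt (zero_at m p) x = wt m x.
Proof.
move=> xp; rewrite /zero_at; apply: eq_bigr => j _.
by have [->|//] := eqVneq j p; rewrite xp eqxx !muln0.
Qed.

Lemma mass_zero_at m p : mass m = m p + mass (zero_at m p).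
Proof.
rewrite /mass /zero_at (bigD1 p) //= [in RHS](bigD1 p) //= eqxx add0n.
by congr (_ + _); apply: eq_bigr => j /negPf ->.
Qed.

Lemma shorten_at D m d p : min_wt_ge D m d ->
  exists2 D' : {vspace 'rV['F_2]_n}, (\dim D).-1 <= \dim D' &
    min_wt_ge D' (zero_at m p) d.
Proof.
move=> min_d; have [D' dimD' D'P] := shorten_coord D p.
by exists D' => // x /D'P[xD xp] x0; rewrite wt_zero_at // min_d.
Qed.

Lemma even_bound k D m d : k <= \dim D -> min_wt_ge D m d ->
  (forall j, ~~ odd (m j)) -> (griesmer k (uphalf d)).*2 <= mass m.
Proof.
move=> dimD min_d m_even; pose h j := (m j)./2.
have mE j : m j = h j * 2 by rewrite /h; have := m_even j; lia.
have -> : mass m = (mass h).*2.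
  by rewrite -muln2 /mass big_distrl; apply: eq_bigr.
rewrite leq_double; apply: (griesmer_bound dimD) => x xD x0.
have := min_d x xD x0; have -> : wt m x = (wt h x).*2; last by lia.
by rewrite -muln2 /wt big_distrl; apply: eq_bigr => j _; rewrite mE mulnAC.
Qed.

End WeightedCodes.

(** * Lower bounds when no multiplicity is 1 *)

Definition loc_bound k d N := forall n (D : {vspace 'rV['F_2]_n}) m,
  k <= \dim D -> min_wt_ge D m d -> (forall j, m j != 1) -> N <= mass m.

Lemma loc_bound_griesmer k d : loc_bound k d (griesmer k d).
Proof. by move=> n D m dimD min_d _; apply: griesmer_bound dimD min_d. Qed.

Lemma loc_boundW k d d' N N' :
  d <= d' -> N' <= N -> loc_bound k d N -> loc_bound k d' N'.
Proof.
move=> le_d le_N bnd n D m dimD min_d m_n1; apply: leq_trans le_N _.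
by apply: bnd dimD _ m_n1; apply: min_wt_geW min_d.
Qed.

Lemma loc_bound_coord k d N n (D : {vspace 'rV['F_2]_n}) m p :
    loc_bound k d N -> k < \dim D -> min_wt_ge D m d ->
  (forall j, m j != 1) -> N + m p <= mass m.
Proof.
move=> bnd dimD min_d m_n1; have [D' dimD' min_D'] := shorten_at p min_d.
rewrite (mass_zero_at m p) addnC leq_add2l; apply: bnd min_D' _; first by lia.
by move=> j; rewrite /zero_at; case: ifP.
Qed.

Lemma loc_boundS k d N : loc_bound k d N ->
  loc_bound k.+1 d (minn (griesmer k.+1 (uphalf d)).*2 (N + 3)).
Proof.
move=> bnd n D m dimD min_d m_n1.
have [m_even|/forallPn[p]] := boolP [forall j, ~~ odd (m j)].
  rewrite geq_min (even_bound dimD min_d) // => j.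
  exact: (forallP m_even).
rewrite negbK => m_odd; have := loc_bound_coord p bnd dimD min_d m_n1.
by have := m_n1 p; lia.
Qed.

Lemma loc_bound4 d :
  loc_bound 4 d (minn (griesmer 4 (uphalf d)).*2 (griesmer 3 d + 3)).
Proof. exact: loc_boundS (@loc_bound_griesmer 3 d). Qed.

(** For [d] = 1, 3, 5 the bound [loc_bound4] gives only 6, 9, 13; treating dimension 3 in the same
    way yields 8, 10, 14. *)
Lemma loc_bound4_rec d :
  loc_bound 4 d (minn (griesmer 4 (uphalf d)).*2
                      (minn (griesmer 3 (uphalf d)).*2 (griesmer 2 d + 3) + 3)).
Proof. exact: loc_boundS (loc_boundS (@loc_bound_griesmer 2 d)). Qed.

Lemma wt_lin n (f g h : 'I_n -> nat) a :
  (forall j, f j = a * g j + h j) -> forall x, wt f x = a * wt g x + wt h x.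
Proof.
move=> fE x; rewrite /wt big_distrr -big_split; apply: eq_bigr => j _ /=.
by rewrite fE mulnDl mulnA.
Qed.

Lemma mass_lin n (f g h : 'I_n -> nat) a :
  (forall j, f j = a * g j + h j) -> mass f = a * mass g + mass h.
Proof.
by move=> fE; rewrite /mass big_distrr -big_split; apply: eq_bigr => j _ /=.
Qed.

Lemma loc_bound_4_10 : loc_bound 4 10 22.
Proof.
move=> n D m dimD min_d m_n1; rewrite leqNgt; apply/negP => lt22.
have bnd3 : loc_bound 3 10 18 by exact: (@loc_bound_griesmer 3 10).
have m_le j : 18 + m j <= mass m.
  exact: loc_bound_coord bnd3 dimD min_d m_n1.
have [p m_p] : exists p, odd (m p).
  apply/existsP; apply: contraLR lt22; rewrite -leqNgt negb_exists => m_even.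
  by apply: (even_bound dimD min_d) => j; apply: (forallP m_even).
have {}m_p : m p = 3 by have := m_le p; have := m_n1 p; lia.
pose h j : nat := m j != 0.
pose o j : nat := m j == 3; pose e j : nat := m j == 2.
have mE j : m j = 2 * h j + o j.
  by have := m_le j; have := m_n1 j; rewrite /h /o; lia.
have hE j : h j = 1 * e j + o j.
  by have := m_le j; have := m_n1 j; rewrite /h /o /e; lia.
have := mass_lin mE; have := mass_lin hE.
have wm := wt_lin mE; have wh := wt_lin hE => toth totm.
(* Every word has [o]-weight at most its [h]-weight, so 10 is at most three times the latter. *)
have totm21 : mass m = 21 by have := m_le p; lia.
have min_h : min_wt_ge D h 4.
  by move=> x xD x0; have := min_d x xD x0; rewrite wm wh; lia.
have toth8 : 8 <= mass h := griesmer_bound dimD min_h.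
have [le_h|lt_h] := leqP (mass h) 8.
  (* A code of length 8 and minimum weight 4 has all weights 4 or 8, so words
     constant on the three coordinates of multiplicity 2 have o-weight >= 4. *)
  have : size (enum [set j | m j == 2]) = 3.
    rewrite -cardE -sum1dep_card; transitivity (mass e); last by lia.
    by rewrite /mass big_mkcond; apply: eq_bigr => j _; rewrite /e; case: eqP.
  case Es : (enum _) => [|a [|b [|c []]]] // _.
  have [D1 dimD1 D1P] := shorten_eq D a b.
  have [D2 dimD2 D2P] := shorten_eq D1 a c.
  have D2E x j : x \in D2 -> m j = 2 -> x ord0 j = x ord0 a.
    move=> /D2P[/D1P[_ ab] ac] mj.
    have : j \in enum [set j | m j == 2] by rewrite mem_enum inE mj.
    by rewrite Es !inE => /or3P[] /eqP ->.
  have min_o : min_wt_ge D2 o 4.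
    move=> x xD2 x0; have [/D1P[xD _] _] := D2P x xD2.
    have we : wt e x = mass e * (x ord0 a != 0%R).
      rewrite /wt /mass big_distrl; apply: eq_bigr => j _ /=.
      by rewrite /e; case: eqP => // /(D2E x j xD2) ->.
    have := leq_wt_mass h x; have := min_h x xD x0; have := min_d x xD x0.
    have [D' dimD' min_D'] := residual_code dimD min_h xD x0.
    have := griesmer_bound dimD' min_D'.
    have := mass_residue h x; rewrite wm.
    (* The residual of such a word would be too short for the Griesmer bound. *)
    have : wt h x \in [:: 5; 6; 7] ->
        8 - wt h x < griesmer 3 (uphalf (4.*2 - wt h x)).
      by rewrite !inE => /or3P[] /eqP ->.
    (* The [e]-weight is 0 or 3. If it is 3, then [h]-weight 4 would give total weight 9, so the
       [h]-weight is 8 and the [o]-weight 5. *)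
    rewrite !inE; have := wh x; rewrite we; case: (x _ _ != _); lia.
  (* Here [mass o] is 5, below the required 6. *)
  have : griesmer 2 4 <= mass o by apply: griesmer_bound min_o; lia.
  by rewrite /=; lia.
(* Shortening at p and then taking the residual of a word of h-weight 4 leaves
   only coordinates of multiplicity 2, where weights are even. *)
have [D1 dimD1 D1P] := shorten_coord D p.
pose h1 := zero_at h p; pose o1 := zero_at o p.
have toth1 : mass h = 1 + mass h1 by rewrite (mass_zero_at h p) {1}/h m_p.
have toto1 : mass o = 1 + mass o1 by rewrite (mass_zero_at o p) {1}/o m_p.
have min1 x : x \in D1 -> x != 0%R -> 10 <= 2 * wt h1 x + wt o1 x.
  by move=> /D1P[xD xp] x0; rewrite !wt_zero_at // -wm min_d.
(* Otherwise Griesmer requires 10 coordinates, but [mass h] is at most 10 and [p] is removed. *)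
have [y /and3P[yD1 y0 hy]] : exists y, [&& y \in D1, y != 0%R & wt h1 y <= 4].
  apply/existsP; apply: contraLR lt_h; rewrite negb_exists => /forallP hD1.
  have : griesmer 3 5 <= mass h1; last by rewrite /=; lia.
  apply: griesmer_bound (_ : min_wt_ge D1 h1 5); first by lia.
  by move=> x xD1 x0; have := hD1 x; rewrite xD1 x0 -ltnNge.
have := min1 y yD1 y0; have oy := leq_wt_mass o1 y => miny.
(* As [mass o1] is at most 2, weight 10 forces equality throughout; only (h, o) = (9, 3)
   survives. *)
have [wh1 wo1] : wt h1 y = 4 /\ wt o1 y = mass o1 by lia.
have o1res := mass_residue o1 y; have h1res := mass_residue h1 y.
have [|D2 dimD2 D2P] := complement_word (k := 2) _ yD1 y0; first by lia.
(* The residual has mass 4, below 5. If [z] has weight r in it, adding the bounds for [z] and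
   [y + z] gives 20 <= 10 + 4r, so r >= 3. *)
have : griesmer 2 3 <= mass (residue h1 y); last by rewrite /=; lia.
apply: griesmer_bound dimD2 _ => z zD2 z0.
have [zD1 yzD1 yz0] := D2P z zD2 z0.
have := min1 _ zD1 z0; have := min1 _ yzD1 yz0.
have := wt_residue h1 y z; have := wt_residue o1 y z.
have := leq_wt_mass (residue o1 y) z; lia.
Qed.

Lemma griesmer_code_length k d n :
  code_length 'F_2 k d n -> griesmer k d <= n.
Proof.
case=> C [dimC minC]; have -> : n = mass (fun _ : 'I_n => 1).
  by rewrite /mass sum1_card card_ord.
apply: (@griesmer_bound _ k C); rewrite ?dimC // => x xC x0.
apply: leq_trans (minC x 0%R xC (mem0v C) x0) _.
rewrite /hamming_dist -sum1dep_card big_mkcond leq_eqVlt; apply/orP; left.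
by apply/eqP/eq_bigr => j _; rewrite mxE mul1n; case: eqP.
Qed.

(** * From locality 1 to multiplicities *)

Section Coalesce.
Variables (n : nat) (C : {vspace 'rV['F_2]_n}).
Definition same_coord (i j : 'I_n) :=
  [forall x : 'rV['F_2]_n, (x \in C) ==> (x ord0 i == x ord0 j)].

(** [pick] depends only on the class of [j], which makes the representative canonical. *)
Definition rep_coord j := odflt j [pick i | same_coord j i].

Definition active_coord j :=
  [exists x : 'rV['F_2]_n, (x \in C) && (x ord0 j != 0%R)].

Lemma same_coordP i j :
  reflect (forall x, x \in C -> x ord0 i = x ord0 j) (same_coord i j).
Proof.
by apply: (iffP 'forall_implyP) => ij x xC; apply/eqP/ij.
Qed.

Lemma rep_coordP x j : x \in C -> x ord0 (rep_coord j) = x ord0 j.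
Proof.
by move=> xC; rewrite /rep_coord; case: pickP => //= i /same_coordP ->.
Qed.

Lemma rep_coord_same i j : same_coord i j -> rep_coord i = rep_coord j.
Proof.
move=> /same_coordP ij; rewrite /rep_coord.
have E : same_coord i =1 same_coord j.
  by move=> l; apply/same_coordP/same_coordP => il x xC; rewrite -il ?ij.
by rewrite (eq_pick E); case: pickP => //= /(_ j)/same_coordP[].
Qed.

(** Coordinate [i] is a nonconstant function of a single bit [j] and maps 0 to 0, hence is the
    identity. Zero coordinates need no twin. *)
Lemma active_coord_twin i :
  has_locality 1 C -> active_coord i -> exists2 j, j != i & same_coord i j.
Proof.
move=> locC /existsP[z /andP[zC zi]]; have [S [iS S1 SP]] := locC i.
have S0 : S != set0.
  apply: contraNneq zi => S0; apply/eqP.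
  rewrite (SP z 0%R zC (mem0v C)) ?mxE // => j; by rewrite S0 inE.
have /cards1P[j Sj] : #|S| == 1 by rewrite eqn_leq S1 card_gt0.
exists j; first by apply: contraNneq iS => <-; rewrite Sj inE.
have jP x y : x \in C -> y \in C -> x ord0 j = y ord0 j -> x ord0 i = y ord0 i.
  by move=> xC yC xy; apply: SP => // l; rewrite Sj inE => /eqP ->.
have zj : z ord0 j != 0%R.
  by apply: contra zi => /eqP zj; rewrite (jP z 0%R) ?mem0v ?mxE.
have F2_eq1 (a : 'F_2) : a != 0%R -> a = 1%R.
  by case: a => [[|[|//]] ?] // _; apply: val_inj.
apply/same_coordP => x xC; have [xj|xj] := eqVneq (x ord0 j) 0%R.
  by rewrite xj (jP x 0%R) ?mem0v ?mxE.
by rewrite (jP x z) ?(F2_eq1 _ zi) ?(F2_eq1 _ zj) ?(F2_eq1 _ xj).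
Qed.

Lemma active_coord_same i j :
  same_coord i j -> active_coord i -> active_coord j.
Proof.
move=> /same_coordP ij /existsP[x /andP[xC xi]]; apply/existsP; exists x.
by rewrite xC -ij.
Qed.

Lemma coalesce : has_locality 1 C -> exists m : 'I_n -> nat,
  [/\ forall j, m j != 1, mass m <= n
    & forall x, x \in C -> wt m x = hamming_dist x 0%R].
Proof.
move=> locC; pose m j := \sum_(i | active_coord i) (rep_coord i == j).
exists m; split=> [j||x xC].
- have [i /andP[ai /eqP ij]|none] :=
      pickP (fun i => active_coord i && (rep_coord i == j)).
    have [i' i'i ii'] := active_coord_twin locC ai.
    rewrite /m (bigD1 i) //= (bigD1 i') ?(active_coord_same ii') //=.
    by rewrite -(rep_coord_same ii') ij eqxx.
  by rewrite /m big1 // => i ai; have := none i; rewrite ai /= => ->.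
- rewrite /mass exchange_big /=.
  apply: (@leq_trans (\sum_(i | active_coord i) 1)).
    apply: leq_sum => i _; rewrite (bigD1 (rep_coord i)) //= eqxx big1 // => j.
    by rewrite eq_sym => /negPf ->.
  by rewrite sum1_card -[X in _ <= X](card_ord n) max_card.
rewrite /wt /m /hamming_dist -sum1dep_card [in RHS]big_mkcond /=.
under eq_bigr do rewrite big_distrl.
rewrite exchange_big /= [LHS]big_mkcond; apply: eq_bigr => i _.
rewrite mxE (bigD1 (rep_coord i)) //= eqxx mul1n.
rewrite big1 ?addn0 => [|j]; last first.
  by rewrite eq_sym => /negPf ->.
rewrite rep_coordP //.
have [_|/negP ai] := boolP (active_coord i); first by case: eqP.
by case: eqP => // /eqP xi; case: ai; apply/existsP; exists x; rewrite xC.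
Qed.

End Coalesce.

Lemma loc_bound_length k d N n :
  loc_bound k d N -> loc_code_length 'F_2 k d 1 n -> N <= n.
Proof.
move=> bnd [C [[dimC minC] locC]].
have [m [m_n1 mass_m wtm]] := coalesce locC; apply: leq_trans mass_m.
apply: bnd (_ : k <= \dim C) _ m_n1; rewrite ?dimC // => x xC x0.
by rewrite wtm // minC // mem0v.
Qed.

(** * Constructions from multisets of points of PG(3,2) *)

(* The number v stands for the point of PG(3,2) whose coordinates are its four
   lowest binary digits. *)
Definition off_plane (a b c d : bool) (v : nat) :=
  a && odd v (+)
  (b && odd (v %/ 2) (+) (c && odd (v %/ 4) (+) (d && odd (v %/ 8)))).

Lemma F2_bool_neq0 (b : bool) : (b%:R != 0 :> 'F_2)%R = b.
Proof. by case: b. Qed.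

Lemma F2_mul_neq0 (x : 'F_2) (b : bool) : (x * b%:R != 0)%R = (x != 0)%R && b.
Proof. by rewrite mulf_eq0 negb_or F2_bool_neq0. Qed.

Lemma card_nth (T : Type) (x0 : T) (s : seq T) (P : pred T) :
  #|[set i : 'I_(size s) | P (nth x0 s i)]| = count P s.
Proof. by rewrite -sum1dep_card -sum1_count (big_nth x0) big_mkord. Qed.

(** The weight of a codeword counts the points off a plane, and a repeated point gives equal columns
    that recover each other. *)
Lemma points_code (s : seq nat) d : 0 < d ->
    (forall a b c e, [|| a, b, c | e] -> d <= count (off_plane a b c e) s) ->
    {in s, forall v, 1 < count_mem v s} ->
  loc_code_length 'F_2 4 d 1 (size s).
Proof.
move=> d_gt0 wt_s loc_s.
pose G : 'M['F_2]_(4, size s) :=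
  (\matrix_(i, j) (odd (nth 0%N s j %/ 2 ^ i))%:R)%R.
pose f := linfun (mulmxr G : 'rV['F_2]_4 -> 'rV['F_2]_(size s)).
have fE u : f u = (u *m G)%R by rewrite lfunE.
have wt_f u : u != 0%R -> d <= #|[set j | f u ord0 j != 0%R]|.
  move=> u0; pose u_ i := u ord0 (inord i : 'I_4) != 0%R.
  have uE j : (f u ord0 j != 0%R) =
      off_plane (u_ 0) (u_ 1) (u_ 2) (u_ 3) (nth 0 s j).
    rewrite fE mxE; under eq_bigr => i _ do rewrite -{1}[i]inord_val mxE.
    rewrite !big_ord_recl big_ord0 addr0 !F2_neq0D !F2_mul_neq0.
    by rewrite divn1.
  under eq_finset do rewrite uE.
  rewrite (card_nth 0 s) wt_s //; apply: contraR u0; rewrite !negb_or !negbK.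
  case/and4P=> u0 u1 u2 u3; apply/eqP/rowP => i; rewrite mxE.
  rewrite -[i]inord_val; apply/eqP; case: i => [[|[|[|[|//]]]] ?] //.
exists (limg f); split; first split.
(* Since [0 < d], encoding has trivial kernel. *)
- rewrite limg_dim_eq ?dimvf ?dim_matrix //; apply/eqP; rewrite -subv0.
  apply/subvP => u; rewrite memv_cap memv_ker memv0 => /andP[_ /eqP fu].
  apply/negPn/negP => /wt_f; rewrite fu leqNgt.
  rewrite (_ : [set _ | _] = set0) ?cards0 ?d_gt0 //.
  by apply/setP => j; rewrite !inE mxE eqxx.
- move=> x y /memv_imgP[u _ ->] /memv_imgP[v _ ->] uv.
  have /wt_f : (u - v != 0)%R by rewrite subr_eq0; apply: contraNneq uv => ->.
  by rewrite /hamming_dist linearB /=; under eq_finset do rewrite !mxE subr_eq0.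
move=> i; have := loc_s _ (mem_nth 0 (ltn_ord i)); rewrite -(card_nth 0).
rewrite (cardsD1 i) inE /= eqxx ltnS => /card_gt0P[j].
rewrite !inE => /andP[ji /eqP /= ji_s].
exists [set j]; rewrite inE eq_sym ji cards1; split=> // x y.
move=> /memv_imgP[u _ ->] /memv_imgP[v _ ->] /(_ j (set11 j)).
have colE w : f w ord0 i = f w ord0 j.
  by rewrite !fE !mxE; apply: eq_bigr => l _; rewrite !mxE ji_s.
by rewrite !colE.
Qed.

Lemma doubled_code (s t : seq nat) d : 0 < d -> {subset t <= s} ->
    (forall a b c e, [|| a, b, c | e] ->
       d <= count (off_plane a b c e) (s ++ s ++ t)) ->
  loc_code_length 'F_2 4 d 1 (size (s ++ s ++ t)).
Proof.
move=> d0 ts wt_st; apply: points_code => // v; rewrite !mem_cat orbA orbb.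
move=> /orP vs; have {vs} : v \in s by case: vs => // /ts.
by rewrite -has_pred1 has_count !count_cat; lia.
Qed.

Definition simplex := iota 1 15.

(* Entry e lists the columns of a code of minimum weight e attaining the
   Griesmer bound; from e = 3 on it is the complement of a subspace of PG(3,2),
   with one more point removed for e = 3 and e = 5. *)
Definition optimal e := nth [::]
  [:: [::]; [:: 1; 2; 4; 8]; [:: 1; 2; 4; 8; 15]; iota 8 7; iota 8 8;
      iota 4 11; iota 4 12; iota 2 14] e.

Lemma griesmer_add8 q e : griesmer 4 (q * 8 + e) = q * 15 + griesmer 4 e.
Proof. by rewrite /=; lia. Qed.

Lemma size_optimal e : e < 8 -> size (optimal e) = griesmer 4 e.
Proof. by move: e; do 8?case. Qed.

Lemma optimal_simplex e : e < 8 -> {subset optimal e <= simplex}.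
Proof. by move=> e8; apply/allP; move: e e8; do 8?case. Qed.

Lemma count_simplex a b c d :
  [|| a, b, c | d] -> count (off_plane a b c d) simplex = 8.
Proof. by case: a b c d => [] [] [] []. Qed.

Lemma count_optimal a b c d e : e < 8 -> [|| a, b, c | d] ->
  e <= count (off_plane a b c d) (optimal e).
Proof. by case: a b c d => [] [] [] [] // e8 _; move: e e8; do 8?case. Qed.

Lemma griesmer_loc_code d : 16 <= d ->
  loc_code_length 'F_2 4 d 1 (griesmer 4 d).
Proof.
move=> d16; pose q := d %/ 8 - 2; pose e := d %% 8.
have e8 : e < 8 by rewrite ltn_mod.
have dE : d = (q + 2) * 8 + e by rewrite /q /e; lia.
(* Each copy of the simplex code adds 15 to the length and 8 to every nonzero weight. *)
pose t := flatten (nseq q simplex) ++ optimal e.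
have -> : griesmer 4 d = size (simplex ++ simplex ++ t).
  rewrite dE griesmer_add8 !size_cat size_flatten /shape map_nseq sumn_nseq.
  by rewrite !size_iota (size_optimal e8); lia.
apply: doubled_code => [|v|a b c f nz]; first by lia.
  by rewrite mem_cat => /orP[/flattenP[u /nseqP[-> _]]|/(optimal_simplex e8)].
rewrite !count_cat count_flatten map_nseq sumn_nseq count_simplex //.
by have := count_optimal e8 nz; lia.
Qed.

Lemma doubled_optimal e : 0 < e < 8 ->
  loc_code_length 'F_2 4 e.*2 1 (griesmer 4 e).*2.
Proof.
case/andP=> e0 e8.
have -> : (griesmer 4 e).*2 = size (optimal e ++ optimal e ++ [::]).
  by rewrite !size_cat size_optimal // addn0 addnn.
apply: doubled_code => // [|a b c f nz]; first by rewrite double_gt0.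
by have := count_optimal e8 nz; rewrite !count_cat /=; lia.
Qed.

(** Two copies of the affine space [iota 8 8] give weight at least 8; the four added points form a
    basis, so every nonzero word gains at least 1. *)
Lemma loc_code_4_9 : loc_code_length 'F_2 4 9 1 20.
Proof.
apply: (@doubled_code (iota 8 8) [:: 8; 9; 10; 12]) => //; first exact/allP.
by do 4!case.
Qed.

Lemma loc_code_4_11 : loc_code_length 'F_2 4 11 1 23.
Proof.
apply: (@doubled_code (iota 8 8) (iota 8 7)) => //; first exact/allP.
by do 4!case.
Qed.

(** Doubling the complement of a line gives weight at least 12. The only nonzero word vanishing on
    the added points already has weight 16. *)
Lemma loc_code_4_13 : loc_code_length 'F_2 4 13 1 27.
Proof.
apply: (@doubled_code (iota 4 12) [:: 4; 5; 6]) => //; first exact/allP.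
by do 4!case.
Qed.

(** * Exact values *)

Lemma min_loc_lengthI d d' N : loc_bound 4 d N ->
  loc_code_length 'F_2 4 d' 1 N -> d <= d' -> min_loc_length 'F_2 4 d 1 N.
Proof.
move=> bnd [C [[dimC minC] locC]] le_d; split=> [|n].
  exists C; do 2?split=> //; move=> x y xC yC xy.
  exact: leq_trans le_d (minC x y xC yC xy).
exact: loc_bound_length bnd.
Qed.

Theorem theorem37 :
  [/\ min_loc_length 'F_2 4 1 1 8 /\ min_loc_length 'F_2 4 2 1 8,
      min_loc_length 'F_2 4 3 1 10 /\ min_loc_length 'F_2 4 4 1 10,
      min_loc_length 'F_2 4 5 1 14 /\ min_loc_length 'F_2 4 6 1 14
    & min_loc_length 'F_2 4 7 1 16 /\ min_loc_length 'F_2 4 8 1 16] /\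
  [/\ min_loc_length 'F_2 4 9 1 20,
      min_loc_length 'F_2 4 10 1 22,
      min_loc_length 'F_2 4 11 1 23
    & min_loc_length 'F_2 4 12 1 24] /\
  [/\ min_loc_length 'F_2 4 13 1 27,
      min_loc_length 'F_2 4 14 1 28
    & min_loc_length 'F_2 4 15 1 30] /\
  (forall d : nat, 16 <= d ->
     exists n : nat, min_length 'F_2 4 d n /\ min_loc_length 'F_2 4 d 1 n).
Proof.
split; [split; split | split; [split | split; [split |]]].
- exact: min_loc_lengthI (@loc_bound4_rec 1) (@doubled_optimal 1 isT) isT.
- exact: min_loc_lengthI (loc_boundW (leqnSn 1) (leqnn 8) (@loc_bound4_rec 1))
    (@doubled_optimal 1 isT) isT.
- exact: min_loc_lengthI (@loc_bound4_rec 3) (@doubled_optimal 2 isT) isT.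
- exact: min_loc_lengthI (loc_boundW (leqnSn 3) (leqnn 10) (@loc_bound4_rec 3))
    (@doubled_optimal 2 isT) isT.
- exact: min_loc_lengthI (@loc_bound4_rec 5) (@doubled_optimal 3 isT) isT.
- exact: min_loc_lengthI (loc_boundW (leqnSn 5) (leqnn 14) (@loc_bound4_rec 5))
    (@doubled_optimal 3 isT) isT.
- exact: min_loc_lengthI (@loc_bound4 7) (@doubled_optimal 4 isT) isT.
- exact: min_loc_lengthI (loc_boundW (leqnSn 7) (leqnn 16) (@loc_bound4 7))
    (@doubled_optimal 4 isT) isT.
- exact: min_loc_lengthI (@loc_bound4 9) loc_code_4_9 isT.
- exact: min_loc_lengthI loc_bound_4_10 (@doubled_optimal 5 isT) isT.
- exact: min_loc_lengthI (@loc_bound4 11) loc_code_4_11 isT.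
- exact: min_loc_lengthI (@loc_bound4 12) (@doubled_optimal 6 isT) isT.
- exact: min_loc_lengthI (@loc_bound4 13) loc_code_4_13 isT.
- exact: min_loc_lengthI (@loc_bound4 14) (@doubled_optimal 7 isT) isT.
(* The doubled simplex code, of minimum weight 16 and length 30, also serves [d] = 15. *)
- exact: min_loc_lengthI (@loc_bound4 15) (@griesmer_loc_code 16 isT) isT.
move=> d d16; exists (griesmer 4 d); have code_d := griesmer_loc_code d16.
split; last exact: min_loc_lengthI (@loc_bound_griesmer 4 d) code_d (leqnn d).
split=> [|n]; last exact: griesmer_code_length.
by have [C [codeC _]] := code_d; exists C.
Qed.
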